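(* There is no polynomial sized CNF decomposition of the AllDifferent domain consistency propagator. That is, there is no polynomial $p$ such that, for every AllDifferent constraint, the domain consistency propagator of this constraint has a CNF decomposition of size at most $p(|\mathbf{x}|)$, where $|\mathbf{x}|$ is the number of literals $X_i=j$ of the initial domains.
   Context: **Domains.** A constraint $C$ is on a finite set of variables $\mathbf{X}$, each $X_i$ having a finite initial domain $D(X_i)$; it allows a subset of the possible assignments (its solutions). A literal is an expression $X_i=j$ with $j\in D(X_i)$. $\mathcal{P}(\mathbf{D})$ is the set of all subsets of the set of initial literals; its elements are domain settings. **AllDifferent.** The AllDifferent constraint on $X_1,\dots,X_n$ has as solutions exactly the assignments giving pairwise distinct values to $X_1,\dots,X_n$. **Domain consistency propagator.** A propagator for $C$ is a polynomial time computable function $f:\mathcal{P}(\mathbf{D})\to\mathcal{P}(\mathbf{D})$ that is monotone for inclusion, contracting ($f(\mathbf{D}')\subseteq\mathbf{D}'$) and idempotent, that removes from $\mathbf{D}'$ only literals belonging to no solution of $C$ using only literals of $\mathbf{D}'$, and that returns $\emptyset$ when it detects that there is no solution. It enforces domain consistency when every literal of $f(\mathbf{D}')$ belongs to a solution of $C$ within $\mathbf{D}'$. So the domain consistency propagator maps $\mathbf{D}'$ to the set of literals of $\mathbf{D}'$ that belong to some solution of $C$ using only literals of $\mathbf{D}'$ (in particular to $\emptyset$ if there is none). **Propositional representation.** There is one Boolean variable $x_{i,j}$ for each initial literal $X_i=j$; $\mathbf{x}$ is the set of these. A domain setting $\mathbf{D}'$ is represented by a partial instantiation of $\mathbf{x}$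 in which $x_{i,j}$ is false iff $(X_i=j)\notin\mathbf{D}'$; if $(X_i=j)\in\mathbf{D}'$ then $x_{i,j}$ is unset, except that it may be true when $j$ is the only remaining value of $X_i$. **Unit propagation.** Starting from a partial instantiation, unit propagation sets a literal to true whenever it appears in a clause all of whose other literals are false, until fixpoint; if all literals of a clause are false, the empty clause is produced. **CNF decomposition of a propagator.** A CNF decomposition of a propagator $f_P$ is a CNF formula $C_P$ over variables $\mathbf{x}\cup\mathbf{y}$, where $\mathbf{x}$ (input variables) is the propositional representation of the domains and $\mathbf{y}$ is a set of auxiliary variables whose number is polynomial in $|\mathbf{x}|$, such that for every domain setting $\mathbf{D}'$ and every representation of it as starting partial instantiation: $x_{i,j}$ is set to false by unit propagation iff $(X_i=j)\notin f_P(\mathbf{D}')$; and unit propagation on $C_P$ produces the empty clause when $f_P(\mathbf{D}')=\emptyset$. The size of a CNF is its total number of literal occurrences. *)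

(* Defs.v *)
From HB Require Import structures.
From mathcomp Require Import all_boot all_order all_algebra.

Set Implicit Arguments.
Unset Strict Implicit.
Unset Printing Implicit Defensive.

Section Constraints.
Variables (X V : finType) (D : X -> {set V}).

(* The literal X_i = j of the initial domains is the pair (i, j). *)
Definition literal := {ij : X * V | ij.2 \in D ij.1}.

Definition assignment := {ffun X -> V}.

(* The assignment [a] uses only literals of the domain setting [D']. *)
Definition within (D' : {set literal}) (a : assignment) : bool :=
  [forall i, (i, a i) \in [set val l | l in D']].

Definition alldifferent (a : assignment) : bool := injectiveb a.

Section Propagators.
Variable C : pred assignment.

Definition supported (D' : {set literal}) (l : literal) : bool :=
  [exists a : assignment, [&& C a, within D' a & a (val l).1 == (val l).2]].

(* The requirement that [f] be computable in polynomial time is omitted: the *)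
(* map [dc_propagator] below is determined by the other conditions.           *)
Definition propagator (f : {set literal} -> {set literal}) : Prop :=
  [/\ forall D1 D2 : {set literal}, D1 \subset D2 -> f D1 \subset f D2,
      forall D' : {set literal}, f D' \subset D',
      forall D', f (f D') = f D' &
      forall (D' : {set literal}) l, l \in D' -> supported D' l -> l \in f D'].

Definition enforces_dc (f : {set literal} -> {set literal}) : Prop :=
  forall (D' : {set literal}) l, l \in f D' -> supported D' l.

Definition dc_propagator (D' : {set literal}) : {set literal} :=
  [set l in D' | supported D' l].

(* [dc_propagator] is the only propagator that enforces domain consistency;   *)
(* in particular it returns the empty set when there is no solution.          *)
Lemma dc_propagatorP (f : {set literal} -> {set literal}) :
  propagator f /\ enforces_dc f <-> f =1 dc_propagator.
Proof.
have mono (D1 D2 : {set literal}) : D1 \subset D2 -> dc_propagator D1 \subset dc_propagator D2.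
  move=> s12; apply/subsetP=> l; rewrite !inE => /andP[lD1 /existsP[a]].
  case/and3P=> Ca /forallP wa al; rewrite (subsetP s12) //=.
  apply/existsP; exists a; rewrite Ca al andbT /=; apply/forallP=> i.
  exact: subsetP (imsetS val s12) _ (wa i).
split=> [[[_ contr _ sound] dc] D'|fE].
  apply/setP=> l; rewrite inE; apply/idP/andP=> [lf|[]]; last exact: sound.
  by rewrite (subsetP (contr D')) // dc.
split; last by move=> D' l; rewrite fE inE => /andP[].
split=> [D1 D2|D'|D'|D' l lD' sl]; rewrite ?fE.
- exact: mono.
- by apply/subsetP=> l; rewrite inE => /andP[].
- apply/setP=> l; rewrite inE; case: (boolP (l \in dc_propagator D')) => //=.
  rewrite inE => /andP[_ /existsP[a /and3P[Ca wa al]]].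
  apply/existsP; exists a; rewrite Ca al andbT /=; apply/forallP=> i.
  have /imsetP[m mD' em] := forallP wa i.
  apply/imsetP; exists m => //; rewrite inE mD' /=.
  by apply/existsP; exists a; rewrite Ca wa -em /=.
- by rewrite inE lD'.
Qed.

End Propagators.

(* A partial instantiation of the Boolean variables x_(i,j) maps each of them *)
(* to [Some b] when it is set to [b], and to [None] when it is unset.         *)
Definition represents (D' : {set literal}) (rho : literal -> option bool) :
    Prop :=
  forall l, (rho l = Some false <-> l \notin D') /\
    (rho l = Some true -> forall l', l' \in D' -> (val l').1 = (val l).1 ->
       l' = l).

End Constraints.

Section CNF.
Variable W : eqType.

(* [(w, true)] is the positive literal and [(w, false)] the negative one. *)
Definition bool_literal := (W * bool)%type.
Definition negl (b : bool_literal) : bool_literal := (b.1, ~~ b.2).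

Definition clause := seq bool_literal.
Definition cnf := seq clause.

Definition cnf_size (F : cnf) : nat := \sum_(c <- F) size c.

(* [up F rho b]: unit propagation on [F] from [rho] makes [b] true. After a   *)
(* conflict a literal and its negation may both be true.                      *)
Inductive up (F : cnf) (rho : W -> option bool) : bool_literal -> Prop :=
| up_start w b : rho w = Some b -> up F rho (w, b)
| up_unit (c : clause) b : c \in F -> b \in c ->
    (forall b', b' \in c -> b' != b -> up F rho (negl b')) -> up F rho b.

Definition up_empty_clause (F : cnf) (rho : W -> option bool) : Prop :=
  exists2 c : clause, c \in F & forall b, b \in c -> up F rho (negl b).

End CNF.

Section Decomposition.
Variables (X V : finType) (D : X -> {set V}) (Y : finType).

Definition unset_aux (rho : literal D -> option bool) :
    literal D + Y -> option bool :=
  fun w => if w is inl l then rho l else None.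

(* [q] is the polynomial bounding the number of auxiliary variables. *)
Definition cnf_decomposition (q : {poly rat})
    (f : {set literal D} -> {set literal D}) (F : cnf (literal D + Y)%type) :
    Prop :=
  (#|Y|%:R <= q.[#|{: literal D}|%:R])%R /\
  forall (D' : {set literal D}) (rho : literal D -> option bool),
    represents D' rho ->
    (forall l, up F (unset_aux rho) (inl l, false) <-> l \notin f D') /\
    (f D' = set0 -> up_empty_clause F (unset_aux rho)).

End Decomposition.

(* Main.v *)
(* Unit propagation from a domain setting is a monotone Horn closure, so a    *)
(* decomposition with small CNF yields a small monotone circuit deciding      *)
(* whether a literal is kept; for n variables with n common values this       *)
(* circuit accepts the graphs of the permutations fixing a given point and    *)
(* rejects bipartite graphs without a perfect matching. Razborov's            *)
(* approximation method shows that no such circuit has polynomial size. Each  *)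
(* gate is approximated by a disjunction of few terms, a term being the       *)
(* conjunction of the edges of a matching of size at most L. The rejected     *)
(* graphs used as tests consist of the monochromatic edges of a two-coloring  *)
(* of the 2n vertices with an odd number of vertices of color [true]. Too     *)
(* many terms contain a sunflower: terms sharing a core C whose further edges *)
(* each have an endpoint outside a kernel K, the sets of covered vertices     *)
(* being disjoint outside K. Given the colors on K, the petals are then       *)
(* monochromatic independently, so that replacing the sunflower by its core   *)
(* changes the value on very few colorings. With n = 2^(15 L), a circuit of   *)
(* size at most 2^(L^2) = n^(L/15) makes too few errors on both kinds of      *)
(* tests to be correct.                                                       *)

Require Import Defs.
From HB Require Import structures.
From mathcomp Require Import all_boot all_order all_algebra all_fingroup.
From mathcomp Require Import zify.

Set Implicit Arguments.
Unset Strict Implicit.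
Unset Printing Implicit Defensive.

(** * Matchings and two-colorings *)

(** Deleting literals from the domains only lets unit propagation derive more. Being underived is
    thus a monotone property of the remaining edges, and unrolling the rounds gives a monotone
    circuit of size polynomial in that of the CNF ([circuit_underived]). By [alldifferent_circuit]
    it separates the permutations fixing a point from the odd colorings: a perfect matching of
    monochromatic edges would pair up the vertices of color [true] ([dc_monochromatic]).

    [approximate_circuit] bounds the errors made when each gate is replaced by a short disjunction
    of small matchings; the sunflower bound [card_not_pluckable] keeps the disjunctions short. The
    approximation of the output is either empty, hence wrong on all permutations fixing the point,
    or it contains a matching with at most L edges, hence wrongly accepts a fraction 2^-(L+1) of the
    colorings. Both exceed the errors allowed ([matching_circuit_lower_bound]). Taking L
    proportional to the degree of the polynomial bounds gives [corollary4]. *)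

Lemma card_bigcup_le (I T : finType) (A : {set I}) (F : I -> {set T}) b :
  (forall i, i \in A -> #|F i| <= b) -> #|\bigcup_(i in A) F i| <= #|A| * b.
Proof.
move=> Fb; rewrite -sum_nat_const.
apply: (@leq_trans (\sum_(i in A) #|F i|)); last exact: leq_sum.
elim/big_rec2: _ => [|i m s _ sm]; first by rewrite cards0.
by rewrite (leq_trans (leq_card_setU _ _)) // leq_add2l.
Qed.

Section Matchings.
Variable n : nat.
Local Notation vertex := ('I_n + 'I_n)%type.
Local Notation edge := ('I_n * 'I_n)%type.
Local Notation coloring := {ffun vertex -> bool}.
Implicit Types (E F C G : {set edge}) (A S : {set {set edge}}) (h : coloring).
Implicit Types (v w : vertex) (K : {set vertex}).

Definition incident w (e : edge) := (inl e.1 == w) || (inr e.2 == w).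

Definition cover E : {set vertex} :=
  [set inl e.1 | e in E] :|: [set inr e.2 | e in E].

Definition matching E : bool :=
  [forall e in E, forall e' in E,
    ((e.1 == e'.1) || (e.2 == e'.2)) ==> (e == e')].

Definition monochromatic h : {set edge} := [set e | h (inl e.1) == h (inr e.2)].

Definition flip w h : coloring := [ffun v => (v == w) (+) h v].

Lemma matchingP E :
  reflect {in E &, forall e e', (e.1 = e'.1 \/ e.2 = e'.2) -> e = e'}
          (matching E).
Proof.
apply: (iffP forall_inP) => [mE e e' Ee Ee' h|mE e Ee].
  move/forall_inP: (mE e Ee) => /(_ e' Ee')/implyP h'; apply/eqP/h'.
  by apply/orP; case: h => ->; rewrite eqxx; [left|right].
apply/forall_inP=> e' Ee'; apply/implyP=> /orP h; apply/eqP/mE => //.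
by case: h => /eqP; [left|right].
Qed.

Lemma matchingS E C : C \subset E -> matching E -> matching C.
Proof.
move=> /subsetP sCE /matchingP mE; apply/matchingP=> e e' Ce Ce'.
by apply: mE; apply: sCE.
Qed.

Lemma coverP E w : reflect (exists2 e, e \in E & incident w e) (w \in cover E).
Proof.
rewrite inE; apply: (iffP orP) => [[]/imsetP[e Ee ->]|[e Ee]].
- by exists e; rewrite // /incident eqxx.
- by exists e; rewrite // /incident eqxx orbT.
by case/orP=> /eqP <-; [left|right]; apply/imsetP; exists e.
Qed.

Lemma card_cover E : #|cover E| <= 2 * #|E|.
Proof.
rewrite (leq_trans (leq_card_setU _ _)) // mul2n -addnn.
by rewrite leq_add ?leq_imset_card.
Qed.

Lemma incident_matching E e e' w :
  matching E -> e \in E -> e' \in E -> incident w e -> incident w e' -> e = e'.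
Proof.
move=> /matchingP mE Ee Ee' /orP[]/eqP<- /orP[]/eqP // [h]; apply: mE => //.
  by left.
by right.
Qed.

Lemma flipK w : involutive (flip w).
Proof. by move=> h; apply/ffunP=> v; rewrite !ffunE addbA addbb. Qed.

(** The endpoints of an edge lie on opposite sides, so the flip recolors at most one of them. *)
Lemma monochromatic_flip w h e :
  (e \in monochromatic (flip w h)) = incident w e (+) (e \in monochromatic h).
Proof.
rewrite !inE !ffunE /incident; case: w => i /=; rewrite ?orbF /=;
  [move: (inl e.1 == inl i :> vertex) | move: (inr e.2 == inr i :> vertex)];
  by move: (h (inl _)) (h (inr _)) => [] [] [].
Qed.

(** The flip is an involution of [B] exchanging [Q] with its negation. *)
Lemma card_flip_half (B : {set coloring}) (Q : pred coloring) w :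
    {in B, forall h, flip w h \in B} -> {in B, forall h, Q (flip w h) = ~~ Q h} ->
  2 * #|[set h in B | Q h]| = #|B|.
Proof.
move=> stB flQ; rewrite -(cardsID [set h | Q h] B) mul2n -addnn.
have -> : [set h in B | Q h] = B :&: [set h | Q h].
  by apply/setP=> h; rewrite !inE.
congr (_ + _).
rewrite -(card_imset (_ :\: _) (inv_inj (flipK w))); congr #|pred_of_set _|.
apply/setP=> h; rewrite !inE; apply/andP/imsetP => [[Bh Qh]|[h' + ->]].
  by exists (flip w h); rewrite ?flipK // !inE stB // flQ ?Qh.
by rewrite !inE => /andP[nQ Bh']; rewrite flQ ?stB.
Qed.

(* Each edge has an endpoint in [K], on which the event [B] does not depend;  *)
(* flipping it shows that the edge is monochromatic with probability 1/2.     *)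
Lemma card_monochromatic (B : {set coloring}) K E :
    matching E ->
    {in K, forall w, {in B, forall h, flip w h \in B}} ->
    {in E, forall e, exists2 w, w \in K & incident w e} ->
  2 ^ #|E| * #|[set h in B | E \subset monochromatic h]| = #|B|.
Proof.
move=> + stB; move: {2}#|E| (erefl #|E|) => k; elim: k E => [|k IH] E cE mE eK.
  move/eqP: (cE); rewrite cards_eq0 => /eqP E0.
  rewrite E0 cards0 mul1n; congr #|pred_of_set _|.
  by apply/setP=> h; rewrite inE sub0set andbT.
have /card_gt0P[e Ee] : 0 < #|E| by rewrite cE.
have cE' : #|E :\ e| = k by move: cE; rewrite (cardsD1 e) Ee => -[].
have sE' : E :\ e \subset E by rewrite subsetDl.
have mE' : matching (E :\ e) by apply: matchingS mE.
have eK' : {in E :\ e, forall e, exists2 w, w \in K & incident w e}.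
  by move=> e' /(subsetP sE'); apply: eK.
rewrite -(IH _ cE' mE' eK') cE cE' expnS -mulnA mulnCA; congr (_ * _).
set B' := [set h in B | E :\ e \subset monochromatic h].
have [w Kw we] := eK e Ee.
have -> : [set h in B | E \subset monochromatic h] =
          [set h in B' | e \in monochromatic h].
  apply/setP=> h; rewrite !inE -andbA; congr (_ && _).
  by rewrite -{1}(setD1K Ee) subUset sub1set andbC inE.
apply: (@card_flip_half _ _ w) => h; rewrite inE; last first.
  by rewrite monochromatic_flip we.
(* In a matching [e] is the only edge at [w], so the flip keeps the other edges monochromatic. *)
case/andP=> Bh /subsetP hE; rewrite inE stB //=; apply/subsetP=> e' Ee'.
rewrite monochromatic_flip hE // addbT; apply/negP=> we'.
move: Ee'; rewrite !inE => /andP[/eqP ne Ee']; apply: ne.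
exact: (incident_matching mE Ee' Ee we' we).
Qed.

End Matchings.

(** * Colorings in which no petal of a sunflower is monochromatic *)

Lemma double_pred_exp x : 0 < x -> 2 * (x - 1) ^ x <= x ^ x.
Proof.
case: x => // x _; rewrite subn1 /=.
have bernoulli k : x ^ k.+1 + k.+1 * x ^ k <= x.+1 ^ k.+1.
  elim: k => [|k IH]; first by rewrite !expn1 expn0 addn1.
  rewrite (expnS x.+1) (leq_trans _ (leq_mul (leqnn _) IH)) // !expnS; lia.
by rewrite (leq_trans _ (bernoulli x)) // !expnS; lia.
Qed.

Lemma exp_pred_le x q k : 0 < x -> q * x <= k -> 2 ^ q * (x - 1) ^ k <= x ^ k.
Proof.
move=> x0 /subnK <-; rewrite !expnD mulnCA leq_mul //.
  by case: (k - _) => // m; rewrite leq_exp2r ?leq_subr.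
rewrite (mulnC q) !expnM -expnMn; case: q => // m.
by rewrite leq_exp2r ?double_pred_exp.
Qed.
Section Approximators.
Variables (n L q : nat).
Local Notation vertex := ('I_n + 'I_n)%type.
Local Notation edge := ('I_n * 'I_n)%type.
Local Notation coloring := {ffun vertex -> bool}.
Implicit Types (E F C G : {set edge}) (A S : {set {set edge}}) (h : coloring).
Implicit Types (v w : vertex) (K : {set vertex}).

Definition accepts A G : bool := [exists E in A, E \subset G].

Definition term E : bool := matching E && (#|E| <= L).

Lemma monochromatic_flip_notin E w h : w \notin cover E ->
  (E \subset monochromatic (flip w h)) = (E \subset monochromatic h).
Proof.
move=> wE; apply/subsetP/subsetP => hE e Ee; move: (hE e Ee);
  by rewrite monochromatic_flip; case: (boolP (incident w e)) => // we;
     case/coverP: wE; exists e.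
Qed.

(** Induction on the petals. The vertices of [E] outside [K] meet neither the core nor the other
    petals, so flipping them preserves the event for the rest of [s]; given that event, [E] is
    monochromatic with probability at least 2^-L. *)
Lemma card_no_petal_seq (s : seq {set edge}) C K :
    uniq s -> cover C \subset K ->
    {in s, forall E, term E /\ C \subset E} ->
    {in s, forall E, {in E :\: C, forall e,
      exists2 w, w \in cover E :\: K & incident w e}} ->
    {in s &, forall E E', E != E' ->
      [disjoint cover E :\: K & cover E' :\: K]} ->
  (2 ^ L) ^ size s * #|[set h | (C \subset monochromatic h) &&
                        ~~ has (fun E => E \subset monochromatic h) s]|
  <= (2 ^ L - 1) ^ size s * #|{: coloring}|.
Proof.
move=> + CK; elim: s => [|E s IH] /=; first by rewrite !mul1n max_card.
case/andP=> Es us tE pE dE.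
have sub F : F \in s -> F \in E :: s by rewrite inE orbC => ->.
have {}IH := IH us (fun F Fs => tE F (sub F Fs)) (fun F Fs => pE F (sub F Fs))
  (fun F F' Fs Fs' => dE F F' (sub F Fs) (sub F' Fs')).
set B := [set h | _ && ~~ has _ s] in IH *.
have Ein : E \in E :: s by rewrite inE eqxx.
have [/andP[mE cE] CE] := tE E Ein.
have stB : {in cover E :\: K, forall w, {in B, forall h, flip w h \in B}}.
  move=> w wE h; rewrite !inE => /andP[hC hs].
  have wK : w \notin K by move: wE; rewrite inE => /andP[].
  rewrite monochromatic_flip_notin ?hC /=; last first.
    by apply: contra wK; apply: (subsetP CK).
  apply: contra hs => /hasP[F Fs hF]; apply/hasP; exists F => //.
  rewrite monochromatic_flip_notin // in hF.
  apply/negP=> wF; have EF : E != F by apply: contraNneq Es => ->.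
  have /pred0P/(_ w) := dE E F Ein (sub F Fs) EF.
  by rewrite /= wE inE wK wF.
have := card_monochromatic (matchingS (subsetDl E C) mE) stB (pE E Ein).
set B1 := [set h in B | _] => cB.
have cB1 : #|B| <= 2 ^ L * #|B1|.
  rewrite -cB leq_mul2r leq_exp2l // (leq_trans _ cE) ?orbT //.
  by rewrite subset_leq_card ?subsetDl.
have -> : [set h | (C \subset monochromatic h) &&
   ~~ ((E \subset monochromatic h) || has (fun F => F \subset monochromatic h) s)]
   = B :\: B1.
  apply/setP=> h; rewrite !inE negb_or.
  case: (boolP (C \subset _)) => //= hC; case: (has _ _); rewrite ?andbF //=.
  rewrite !andbT; congr (~~ _); rewrite -{1}(setID E C) (setIidPr CE).
  by rewrite subUset hC.
have sB : B1 \subset B by apply/subsetP=> h; rewrite inE => /andP[].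
have cD : 2 ^ L * #|B :\: B1| <= (2 ^ L - 1) * #|B|.
  rewrite mulnBl mul1n cardsD (setIidPr sB) mulnBr leq_sub2l //.
rewrite !expnS -mulnA mulnCA (leq_trans (leq_mul (leqnn _) cD)) //.
by rewrite mulnCA -mulnA leq_mul2l IH orbT.
Qed.

Lemma card_no_petal S C K :
    q * 2 ^ L <= #|S| -> cover C \subset K ->
    {in S, forall E, term E /\ C \subset E} ->
    {in S, forall E, {in E :\: C, forall e,
      exists2 w, w \in cover E :\: K & incident w e}} ->
    {in S &, forall E E', E != E' ->
      [disjoint cover E :\: K & cover E' :\: K]} ->
  #|[set h | (C \subset monochromatic h) && ~~ accepts S (monochromatic h)]|
    * 2 ^ q <= #|{: coloring}|.
Proof.
move=> cS CK tS pS dS.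
have sub E : E \in enum S -> E \in S by rewrite mem_enum.
have := card_no_petal_seq (enum_uniq S) CK (fun E ES => tS E (sub E ES))
  (fun E ES => pS E (sub E ES)) (fun E F ES FS => dS E F (sub E ES) (sub F FS)).
rewrite -cardE; set B := [set h | _]; set B' := [set h | _] => cB.
have -> : B' = B.
  apply/setP=> h; rewrite !inE; congr (_ && ~~ _).
  apply/existsP/hasP => -[E].
    by case/andP=> ES hE; exists E; rewrite ?mem_enum.
  by rewrite mem_enum => ES hE; exists E; rewrite ES.
have x0 : 0 < (2 ^ L) ^ #|S| by rewrite !expn_gt0.
rewrite -(leq_pmul2l x0) mulnA (leq_trans (leq_mul cB (leqnn _))) //.
rewrite mulnAC leq_mul // mulnC exp_pred_le // expn_gt0 //.
Qed.

End Approximators.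

(** * Sunflowers of matchings *)

Section Sunflowers.
Variables (n L q : nat).
Local Notation vertex := ('I_n + 'I_n)%type.
Local Notation edge := ('I_n * 'I_n)%type.
Local Notation coloring := {ffun vertex -> bool}.
Local Notation accepts := (@accepts n).
Local Notation term := (@term n L).
Implicit Types (E F C G : {set edge}) (A S : {set {set edge}}) (h : coloring).
Implicit Types (v w z : vertex) (K : {set vertex}).

(** Stated through the error of replacing [S] by [C] rather than through the shape of a sunflower,
    so that a family containing its own core qualifies too, with error zero. *)
Definition pluckable A : bool :=
  [exists S : {set {set edge}}, exists C : {set edge},
    [&& S \subset A, 1 < #|S|, [forall E in S, C \subset E] &
      #|[set h | (C \subset monochromatic h) &&
                 ~~ accepts S (monochromatic h)]| * 2 ^ q
        <= #|{: coloring}|]].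

Lemma pluckableP A :
  reflect (exists S C, [/\ S \subset A, 1 < #|S|, {in S, forall E, C \subset E} &
    #|[set h | (C \subset monochromatic h) && ~~ accepts S (monochromatic h)]|
      * 2 ^ q <= #|{: coloring}|]) (pluckable A).
Proof.
apply: (iffP existsP) => [[S /existsP[C /and4P[SA S1 /forall_inP CS hS]]]|].
  by exists S, C; split.
case=> S [C [SA S1 CS hS]]; exists S; apply/existsP; exists C.
by apply/and4P; split=> //; apply/forall_inP.
Qed.

Definition inside K E := [set e in E | (inl e.1 \in K) && (inr e.2 \in K)].

Definition pattern_class A K C : {set {set edge}} :=
  [set E in A | (K \subset cover E) && (inside K E == C)].

(** At most one edge; empty when [z] and [w] are on the same side. *)
Definition joining z w : {set edge} :=
  [set e | (inl e.1 == z) && (inr e.2 == w) || (inl e.1 == w) && (inr e.2 == z)].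

Lemma inside_sub K E : inside K E \subset E.
Proof. by apply/subsetP=> e; rewrite inE => /andP[]. Qed.

Lemma inside_cover K E : cover E \subset K -> inside K E = E.
Proof.
move=> /subsetP EK; apply/setP=> e; rewrite inE; case: (boolP (e \in E)) => // Ee.
by rewrite !EK //; apply/coverP; exists e; rewrite // /incident eqxx ?orbT.
Qed.

(** At most one edge of the matching joins [z] to [K], so enlarging [K] by [z] leaves at most #|K| +
    1 possible patterns. *)
Lemma inside_setU1 z K E : matching E -> z \notin K ->
  inside (z |: K) E \in
    inside K E |: [set joining z w :|: inside K E | w in K].
Proof.
move=> mE zK; rewrite inE.
case: (pickP (fun e => (e \in E) && [exists w in K, e \in joining z w]))
  => /= [e|no].
  case/andP=> Ee /existsP[w /andP[Kw jw]]; apply/orP; right.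
  apply/imsetP; exists w => //; apply/setP=> e'.
  have eE f : f \in joining z w -> f = e.
    move: jw; rewrite !inE.
    case/orP=> /andP[/eqP h1 /eqP h2] /orP[]/andP[/eqP h3 /eqP h4].
    - by case: e f h1 h2 h3 h4 Ee => a b [c d] /= <- <- [->] [->].
    - by move: h3 h4; rewrite -h1 -h2.
    - by move: h3 h4; rewrite -h1 -h2.
    - by case: e f h1 h2 h3 h4 Ee => a b [c d] /= <- <- [->] [->].
  apply/idP/idP; last first.
    rewrite !inE => /orP[j|/and3P[-> -> ->]]; last by rewrite !orbT.
    have -> : e' = e by apply: eE; rewrite inE.
    rewrite Ee /=; move: jw; rewrite inE.
    by case/orP=> /andP[/eqP-> /eqP->]; rewrite eqxx Kw ?orbT.
  rewrite !inE => /andP[Ee']; rewrite Ee' /=.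
  have ie : incident z e.
    by move: jw; rewrite inE /incident => /orP[]/andP[h1 h2]; rewrite ?h1 ?h2 ?orbT.
  have hz : incident z e' -> (e' \in joining z w).
    move=> ie'; rewrite (incident_matching mE Ee' Ee ie' ie); exact: jw.
  rewrite inE in hz.
  case: (boolP (incident z e')) => [/hz -> //|].
  rewrite /incident negb_or => /andP[/negbTE-> /negbTE->].
  by case/andP=> /= -> ->; rewrite orbT.
apply/orP; left; rewrite inE; apply/eqP/setP=> e; rewrite !inE.
case: (boolP (e \in E)) => //= Ee.
have jn w : w \in K -> e \in joining z w = false.
  move=> Kw; apply/negP=> jw; have := no e; rewrite Ee /=.
  by move/negbT/existsP; apply; exists w; rewrite Kw.
case: (altP (inl e.1 =P z)) => [ez|_] /=.
  have -> : inl e.1 \in K = false by rewrite ez (negbTE zK).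
  apply/negP; rewrite orbC => /orP[Kw|/eqP zz]; last by rewrite -ez in zz.
  by have := jn _ Kw; rewrite inE ez !eqxx.
case: (altP (inr e.2 =P z)) => [ez|_] //=.
rewrite andbT andbC ez (negbTE zK) /=; apply/negP => Kw.
by have := jn _ Kw; rewrite inE ez !eqxx orbT.
Qed.

(** A sunflower argument by induction on the number of vertices still missing from [K]. Each step
    adds a vertex [z] from at most 2 L q 2^L candidates and then a pattern from at most 2 L; once
    #|K| = 2 L, [K] is all that a term can cover. *)
Lemma card_pattern_class A :
    {in A, forall E, term E} -> ~~ pluckable A -> 1 < q * 2 ^ L ->
  forall m K C, #|K| + m = 2 * L ->
  #|pattern_class A K C| <= (2 * L * (q * 2 ^ L) * (2 * L)) ^ m.
Proof.
move=> tA npl r1; elim=> [|m IH] K C cK.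
  rewrite expn0 -(cards1 C) subset_leq_card //; apply/subsetP=> E.
  rewrite !inE => /and3P[AE KE /eqP<-].
  have /andP[_ cE] := tA E AE.
  have /eqP KE' : K == cover E.
    rewrite eqEcard KE (leq_trans (card_cover E)) //; move: cK; lia.
  by rewrite inside_cover // KE'.
set A1 := pattern_class A K C.
have A1A : {in A1, forall E, E \in A} by move=> E; rewrite inE => /andP[].
have A1C : {in A1, forall E, C \subset E}.
  by move=> E; rewrite inE => /and3P[_ _ /eqP<-]; apply: inside_sub.
have R0 : 0 < (2 * L * (q * 2 ^ L) * (2 * L)) ^ m.+1.
  rewrite expn_gt0; apply/orP; left; have : 0 < 2 * L by rewrite -cK addnS.
  by move: r1; case: (q * _) => // r _; case: (2 * L).
(* If the core is itself a member, plucking the whole class costs nothing, so the class has no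
   second member. *)
case: (boolP (C \in A1)) => CA1.
  rewrite (leq_trans _ R0) // leqNgt; apply/negP=> A1gt.
  apply: (negP npl); apply/pluckableP; exists A1, C; split=> //.
    exact/subsetP.
  rewrite [X in #|pred_of_set X|](_ : _ = set0) ?cards0 //.
  apply/setP=> h; rewrite !inE; apply/negP=> /andP[hC /negP]; apply.
  by apply/existsP; exists C; rewrite CA1.
have petal : {in A1, forall E, {in E :\: C, forall e,
      exists2 w, w \in cover E :\: K & incident w e}}.
  move=> E; rewrite inE => /and3P[AE _ /eqP<-] e; rewrite !inE.
  case/andP=> + Ee; rewrite Ee /= negb_and => /orP[]nK.
    exists (inl e.1); rewrite /incident ?eqxx // inE nK; apply/coverP.
    by exists e; rewrite // /incident eqxx.
  exists (inr e.2); rewrite /incident ?eqxx ?orbT // inE nK; apply/coverP.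
  by exists e; rewrite // /incident eqxx orbT.
have ne : {in A1, forall E, exists w, w \in cover E :\: K}.
  move=> E AE; have : ~~ (E \subset C).
    apply: contra CA1 => EC; suff <- : E = C by [].
    by apply/eqP; rewrite eqEsubset EC A1C.
  case/subsetPn=> e Ee eC; have [|w ? _] := petal E AE e; last by exists w.
  by rewrite inE eC.
have CK : A1 != set0 -> cover C \subset K.
  case/set0Pn=> E; rewrite inE => /and3P[_ _ /eqP<-].
  apply/subsetP=> w /coverP[e]; rewrite inE => /and3P[_ k1 k2].
  by case/orP=> /eqP<-.
(* A maximal subfamily with covers disjoint outside [K] is a sunflower with core [C]; as [A] is not
   pluckable, it has few members. *)
pose P (S : {set {set edge}}) := (S \subset A1) &&
   [forall E in S, forall F in S, (E != F) ==>
      [disjoint cover E :\: K & cover F :\: K]].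
have [S /maxsetP[/andP[SA1 /forall_inP dS] maxS]] : {S | maxset P S}.
  apply: ex_maxset; exists set0; rewrite /P sub0set; apply/forall_inP=> E.
  by rewrite inE.
have dSP : {in S &, forall E F, E != F -> [disjoint cover E :\: K & cover F :\: K]}.
  by move=> E F ES FS; move/forall_inP: (dS E ES) => /(_ F FS)/implyP.
have [->|A1n0] := eqVneq A1 set0; first by rewrite cards0.
have cS : #|S| <= q * 2 ^ L.
  rewrite leqNgt; apply/negP=> Sgt; apply: (negP npl).
  apply/pluckableP; exists S, C; split.
  - by apply/subsetP=> E /(subsetP SA1); apply: A1A.
  - by rewrite (leq_trans r1) // ltnW.
  - by move=> E /(subsetP SA1); apply: A1C.
  - apply: (@card_no_petal n L q S C K) => //; first exact: ltnW.
    + exact: CK.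
    + by move=> E /(subsetP SA1) EA1; rewrite tA ?A1A ?A1C.
    + by move=> E /(subsetP SA1); apply: petal.
pose Z := \bigcup_(E in S) (cover E :\: K).
have cZ : #|Z| <= 2 * L * (q * 2 ^ L).
  rewrite mulnC (leq_trans (card_bigcup_le (b := 2 * L) _)) ?leq_mul //.
  move=> E /(subsetP SA1) /A1A /tA /andP[_ cE].
  rewrite (leq_trans (subset_leq_card (subsetDl _ _))) //.
  by rewrite (leq_trans (card_cover _)) // leq_mul.
pose pats z : {set {set edge}} := C |: [set joining z w :|: C | w in K].
have cpats z : #|pats z| <= 2 * L.
  rewrite /pats cardsU1 (leq_trans (leq_add (leq_b1 _) (leq_imset_card _ _))) //.
  by rewrite -cK addnS add1n ltnS leq_addr.
have sub : A1 \subset \bigcup_(z in Z) \bigcup_(P in pats z) pattern_class A (z |: K) P.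
  apply/subsetP=> E EA1.
  (* Members of [S] meet [Z] by [ne]; any other member missing [Z] could be added to [S]. *)
  have [z Zz Ez] : exists2 z, z \in Z & z \in cover E :\: K.
    have inZ F w : F \in S -> w \in cover F :\: K -> w \in Z.
      by move=> FS wF; apply/bigcupP; exists F.
    case: (boolP (E \in S)) => [ES|ES].
      by have [w wE] := ne E EA1; exists w => //; apply: inZ wE.
    case: (boolP [exists z in Z, z \in cover E :\: K]) => [/exists_inP[z]|].
      by exists z.
    rewrite negb_exists_in => /forall_inP noZ; case/negP: (ES).
    rewrite -(maxS (E |: S)) ?inE ?eqxx ?subsetUr //.
    apply/andP; split; first by rewrite subUset sub1set EA1.
    have dE F : F \in S -> [disjoint cover E :\: K & cover F :\: K].
      move=> FS; apply/pred0P=> w /=; apply/negP=> /andP[wE wF].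
      by case/negP: (noZ w (inZ _ _ FS wF)).
    apply/forall_inP=> F; rewrite !inE => /orP[/eqP->|FS]; apply/forall_inP=> F';
      rewrite !inE => /orP[/eqP->|FS']; apply/implyP=> FF'; rewrite ?eqxx // in FF' *.
    - exact: dE.
    - by rewrite disjoint_sym dE.
    - exact: dSP.
  apply/bigcupP; exists z => //; apply/bigcupP; exists (inside (z |: K) E).
    move: (EA1); rewrite inE => /and3P[AE _ /eqP eC]; rewrite /pats -eC.
    apply: inside_setU1; first by case/andP: (tA E AE).
    by move: Ez; rewrite inE => /andP[].
  move: EA1 Ez; rewrite !inE => /and3P[-> KE _] /andP[_ zE].
  by rewrite eqxx andbT subUset sub1set KE inE zE.
rewrite (leq_trans (subset_leq_card sub)) // expnS.
rewrite (leq_trans (card_bigcup_le (b := 2 * L *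
   (2 * L * (q * 2 ^ L) * (2 * L)) ^ m) _)) //; last first.
  by rewrite mulnA leq_mul // leq_mul.
move=> z /bigcupP[E _]; rewrite inE => /andP[zK _].
rewrite (leq_trans (card_bigcup_le (b :=
   (2 * L * (q * 2 ^ L) * (2 * L)) ^ m) _)) ?leq_mul //.
by move=> F _; apply: IH; rewrite cardsU1 zK -cK; lia.
Qed.

Lemma card_not_pluckable A :
    {in A, forall E, term E} -> ~~ pluckable A -> 1 < q * 2 ^ L ->
  #|A| <= (2 * L * (q * 2 ^ L) * (2 * L)) ^ (2 * L).
Proof.
move=> tA npl r1.
rewrite (leq_trans _ (@card_pattern_class A tA npl r1 _ set0 set0 _)) ?cards0 //.
rewrite subset_leq_card //; apply/subsetP=> E AE; rewrite inE AE sub0set /=.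
by apply/eqP/setP=> e; rewrite !inE !andbF.
Qed.

End Sunflowers.

(** * Approximation of gates and circuits *)

Section PermutationGraphs.
Variable n : nat.
Local Notation edge := ('I_n * 'I_n)%type.
Implicit Types (E F G : {set edge}) (s : 'S_n).

Definition perm_graph s : {set edge} := [set e | s e.1 == e.2].

Lemma matching_perm_graph E s : E \subset perm_graph s -> matching E.
Proof.
move=> /subsetP Es; apply/matchingP=> -[a b] [c d] /Es + /Es.
rewrite !inE /= => /eqP<- /eqP<- [->//|/perm_inj ->//].
Qed.

(** Composing with the inverse of one such permutation [s0] gives permutations that fix the left
    endpoints of [E]. *)
Lemma card_perm_graph E : #|[set s | E \subset perm_graph s]| <= (n - #|E|)`!.
Proof.
have [->|/set0Pn[s0]] := eqVneq [set s | E \subset perm_graph s] set0.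
  by rewrite cards0.
rewrite inE => Es0.
have /matchingP mE := matching_perm_graph Es0.
have cE : #|~: [set e.1 | e in E]| = n - #|E|.
  rewrite cardsCs setCK card_ord card_in_imset // => e e' Ee Ee' ee'.
  by apply: mE => //; left.
rewrite -cE -card_perm -(card_imset _ (@mulIg _ s0^-1%g)).
apply: subset_leq_card; apply/subsetP=> _ /imsetP[s + ->]; rewrite inE => Es.
apply/subsetP=> i; apply: contraTT; rewrite inE negbK inE.
case/imsetP=> e Ee ->; rewrite negbK permM.
have := subsetP Es e Ee; have := subsetP Es0 e Ee; rewrite !inE.
by move=> /eqP<- /eqP->; rewrite permK.
Qed.

Lemma perm_graph_fix_card (i : 'I_n) : (n.-1)`! <= #|[set s : 'S_n | s i == i]|.
Proof.
have <- : #|~: [set i]| = n.-1.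
  by rewrite cardsCs setCK cards1 card_ord subn1.
rewrite -card_perm; apply: subset_leq_card; apply/subsetP=> s Ps.
by rewrite inE (out_perm Ps) // !inE eqxx.
Qed.

End PermutationGraphs.

Section Gates.
Variables (n L q : nat).
Local Notation vertex := ('I_n + 'I_n)%type.
Local Notation edge := ('I_n * 'I_n)%type.
Local Notation coloring := {ffun vertex -> bool}.
Local Notation accepts := (@accepts n).
Local Notation term := (@term n L).
Implicit Types (E F C G : {set edge}) (A S : {set {set edge}}) (h : coloring).

Hypothesis q_large : 1 < q * 2 ^ L.

Definition max_terms := (2 * L * (q * 2 ^ L) * (2 * L)) ^ (2 * L).

Definition approximator A : bool :=
  [forall E in A, term E] && (#|A| <= max_terms).

(** Each plucking trades at least two terms for their core, so at most #|A| pluckings occur, each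
    adding an error of at most 2^-q. Acceptance only grows, as a core is contained in its petals. *)
Lemma pluck A : {in A, forall E, term E} ->
  exists A', [/\ approximator A',
    forall G, accepts A G -> accepts A' G &
    #|[set h | accepts A' (monochromatic h) && ~~ accepts A (monochromatic h)]|
      * 2 ^ q <= #|A| * #|{: coloring}|].
Proof.
move: {2}#|A|.+1 (ltnSn #|A|) => k; elim: k A => // k IH A Ak tA.
have [cA|cA] := leqP #|A| max_terms.
  exists A; split=> //; first by apply/andP; split=> //; apply/forall_inP.
  rewrite [X in #|pred_of_set X|](_ : _ = set0) ?cards0 //.
  by apply/setP=> h; rewrite !inE andbN.
have /pluckableP[S [C [SA S1 CS hS]]] : pluckable q A.
  by apply: contraLR cA => npl; rewrite -leqNgt card_not_pluckable.
set A1 := C |: (A :\: S).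
have tA1 : {in A1, forall E, term E}.
  move=> E; rewrite !inE => /orP[/eqP->|/andP[_ /tA]//].
  have /card_gt0P[F FS] : 0 < #|S| by rewrite (leq_trans _ S1).
  have /andP[mF cF] := tA F (subsetP SA F FS).
  by rewrite /term (matchingS (CS F FS)) // (leq_trans (subset_leq_card (CS F FS))).
have cA1 : #|A1| < #|A|.
  rewrite /A1 cardsU1 cardsD (setIidPr SA); have := subset_leq_card SA.
  by move: S1; case: (_ \notin _) => /=; move: #|S| #|A|; lia.
have [|A' [apA' mA' eA']] := IH A1 _ tA1; first by rewrite (leq_trans cA1).
exists A'; split=> // [G /exists_inP[E EA EG]|].
  apply: mA'; apply/exists_inP; case: (boolP (E \in S)) => ES.
    by exists C; rewrite ?inE ?eqxx // (subset_trans (CS E ES)).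
  by exists E; rewrite // !inE EA ES orbT.
apply: (@leq_trans ((#|A1| + 1) * #|{: coloring}|)); last first.
  by rewrite leq_mul2r addn1 cA1 orbT.
rewrite mulnDl mul1n (leq_trans _ (leq_add eA' hS)) // -mulnDl leq_mul2r.
apply/orP; right; apply: leq_trans (leq_card_setU _ _).
apply: subset_leq_card; apply/subsetP=> h; rewrite !inE => /andP[-> nA] /=.
case: (boolP (accepts A1 _)) => //= /exists_inP[E].
rewrite !inE => /orP[/eqP->->|/andP[_ EA] Eh] /=.
  apply: contra nA => /exists_inP[F FS Fh]; apply/exists_inP; exists F => //.
  exact: (subsetP SA).
by case/negP: nA; apply/exists_inP; exists E.
Qed.

(** Distribute the conjunction, drop the unions that are not terms, then pluck. Dropping loses only
    permutations, plucking errs only on colorings. *)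
Lemma approximate_and A A' : approximator A -> approximator A' ->
  exists A'', [/\ approximator A'',
    #|[set s : 'S_n | [&& accepts A (perm_graph s), accepts A' (perm_graph s) &
        ~~ accepts A'' (perm_graph s)]]| <= 2 * max_terms ^ 2 * (n - L.+1)`! &
    #|[set h | accepts A'' (monochromatic h) &&
        ~~ (accepts A (monochromatic h) && accepts A' (monochromatic h))]|
      * 2 ^ q <= 2 * max_terms ^ 2 * #|{: coloring}|].
Proof.
case/andP=> /forall_inP tA cA /andP[/forall_inP tA' cA'].
pose A0 := [set E in [set P.1 :|: P.2 | P in setX A A'] | term E].
have cX : #|setX A A'| <= 2 * max_terms ^ 2.
  by rewrite cardsX mul2n -addnn (leq_trans _ (leq_addr _ _)) // -mulnn leq_mul.
have cA0 : #|A0| <= 2 * max_terms ^ 2.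
  apply: leq_trans cX; apply: leq_trans (leq_imset_card (fun P => P.1 :|: P.2) _).
  by rewrite subset_leq_card //; apply/subsetP=> E; rewrite inE => /andP[].
have [|A'' [apA'' mA'' eA'']] := @pluck A0; first by move=> E; rewrite inE => /andP[].
exists A''; split=> //; last first.
  rewrite (leq_trans _ (leq_trans eA'' _)) ?leq_mul //.
  apply: subset_leq_card; apply/subsetP=> h; rewrite !inE => /andP[->] /=.
  apply: contra => /exists_inP[E]; rewrite inE => /andP[/imsetP[F]].
  rewrite inE => /andP[F1 F2] ->{E} _; rewrite subUset => /andP[h1 h2].
  by apply/andP; split; apply/exists_inP; [exists F.1 | exists F.2].
(* A dropped union lying in a permutation graph is a matching, hence has more than [L] edges and
   lies in at most (n - L - 1)! such graphs. *)
pose X := [set P in setX A A' | (L < #|P.1 :|: P.2|) && matching (P.1 :|: P.2)].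
pose B P := [set s : 'S_n | (P.1 :|: P.2) \subset perm_graph s].
apply: (@leq_trans #|\bigcup_(F in X) B F|).
  apply: subset_leq_card; apply/subsetP=> s; rewrite !inE.
  case/and3P=> /exists_inP[E EA Es] /exists_inP[E' EA' Es'] nA''.
  have EEs : E :|: E' \subset perm_graph s by rewrite subUset Es.
  have mEE := matching_perm_graph EEs.
  apply/bigcupP; exists (E, E'); last by rewrite inE.
  rewrite !inE /= EA EA' mEE andbT /= ltnNge andbT; apply: contra nA'' => cEE.
  apply: mA''; apply/exists_inP; exists (E :|: E') => //.
  rewrite inE /term mEE cEE !andbT; apply/imsetP; exists (E, E') => //.
  by rewrite inE EA.
rewrite (leq_trans (card_bigcup_le (b := (n - L.+1)`!) _)) //; last first.
  rewrite leq_mul2r (leq_trans _ cX) ?orbT // subset_leq_card //.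
  by apply/subsetP=> F; rewrite inE => /andP[].
move=> F; rewrite inE => /and3P[_ LF _]; rewrite (leq_trans (card_perm_graph _)) //.
by rewrite leq_fact // leq_sub2l.
Qed.

Lemma approximate_or A A' : approximator A -> approximator A' ->
  exists A'', [/\ approximator A'',
    forall G, accepts A G || accepts A' G -> accepts A'' G &
    #|[set h | accepts A'' (monochromatic h) &&
        ~~ (accepts A (monochromatic h) || accepts A' (monochromatic h))]|
      * 2 ^ q <= 2 * max_terms ^ 2 * #|{: coloring}|].
Proof.
case/andP=> /forall_inP tA cA /andP[/forall_inP tA' cA'].
have acU G : accepts (A :|: A') G = accepts A G || accepts A' G.
  apply/exists_inP/orP => [[E]|].
    by rewrite inE => /orP[]EA EG; [left | right]; apply/exists_inP; exists E.
  by case=> /exists_inP[E EA EG]; exists E; rewrite // inE EA ?orbT.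
have [|A'' [apA'' mA'' eA'']] := @pluck (A :|: A').
  by move=> E; rewrite inE => /orP[/tA|/tA'].
exists A''; split=> // [G|]; first by rewrite -acU; apply: mA''.
under eq_finset => h do rewrite -acU.
rewrite (leq_trans eA'') // leq_mul2r (leq_trans (leq_card_setU _ _)) ?orbT //.
rewrite (leq_trans (leq_add cA cA')) // addnn -mul2n leq_mul2l /= -mulnn.
by case: max_terms => // m; rewrite leq_pmull.
Qed.
End Gates.

(* A monotone circuit on the variables [T], as the list of the functions its  *)
(* gates compute; a function is given by the set of inputs that it accepts.   *)
Inductive circuit (T : finType) : seq {set {set T}} -> Prop :=
| circuit_nil : circuit [::]
| circuit_true c : circuit c -> circuit (setT :: c)
| circuit_false c : circuit c -> circuit (set0 :: c)
| circuit_var c (e : T) : circuit c -> circuit ([set G : {set T} | e \in G] :: c)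
| circuit_and c f g : circuit c -> f \in c -> g \in c -> circuit (f :&: g :: c)
| circuit_or c f g : circuit c -> f \in c -> g \in c -> circuit (f :|: g :: c).

Section CircuitApproximation.
Variables (n L q : nat).
Local Notation vertex := ('I_n + 'I_n)%type.
Local Notation edge := ('I_n * 'I_n)%type.
Local Notation coloring := {ffun vertex -> bool}.
Local Notation accepts := (@accepts n).
Local Notation M := (max_terms L q).
Implicit Types (f : {set {set edge}}) (h : coloring) (s : 'S_n).
Implicit Types (A : {set {set edge}}) (Bp : {set 'S_n}) (Bn : {set coloring}).
Hypotheses (q_large : 1 < q * 2 ^ L) (L_gt0 : 0 < L).

(** Errors are one-sided: outside [Bp] no permutation is lost, outside [Bn] no coloring is
    gained. *)
Definition approximates (Bp : {set 'S_n}) (Bn : {set coloring}) f A : Prop :=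
  [/\ approximator L q A,
    forall s, s \notin Bp -> perm_graph s \in f -> accepts A (perm_graph s) &
    forall h, h \notin Bn -> accepts A (monochromatic h) -> monochromatic h \in f].

Lemma approximatesW Bp Bp' Bn Bn' f A : Bp \subset Bp' -> Bn \subset Bn' ->
  approximates Bp Bn f A -> approximates Bp' Bn' f A.
Proof.
move=> sp sn [apA pA nA]; split=> // [s sB|h hB].
  by apply: pA; apply: contra sB; apply: (subsetP sp).
by apply: nA; apply: contra hB; apply: (subsetP sn).
Qed.

Lemma max_terms_gt0 : 0 < M.
Proof.
rewrite expn_gt0 !muln_gt0 L_gt0 /= andbT; apply/orP; left.
by rewrite expn_gt0 andbT; case: q q_large.
Qed.

Lemma approximate_circuit c : circuit c ->
  exists Bp Bn,
    [/\ #|Bp| <= size c * (2 * M ^ 2 * (n - L.+1)`!),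
        #|Bn| * 2 ^ q <= size c * (2 * M ^ 2 * #|{: coloring}|) &
        {in c, forall f, exists A, approximates Bp Bn f A}].
Proof.
move: c; have M0 := max_terms_gt0.
have step c Bp Bn f :
    [/\ #|Bp| <= size c * (2 * M ^ 2 * (n - L.+1)`!),
        #|Bn| * 2 ^ q <= size c * (2 * M ^ 2 * #|{: coloring}|) &
        {in c, forall f, exists A, approximates Bp Bn f A}] ->
    (exists Bp' Bn' A,
      [/\ #|Bp'| <= 2 * M ^ 2 * (n - L.+1)`!,
          #|Bn'| * 2 ^ q <= 2 * M ^ 2 * #|{: coloring}| &
          approximates (Bp :|: Bp') (Bn :|: Bn') f A]) ->
  exists Bp Bn,
    [/\ #|Bp| <= size (f :: c) * (2 * M ^ 2 * (n - L.+1)`!),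
        #|Bn| * 2 ^ q <= size (f :: c) * (2 * M ^ 2 * #|{: coloring}|) &
        {in f :: c, forall f, exists A, approximates Bp Bn f A}].
  case=> cp cn hc [Bp' [Bn' [A [cp' cn' hA]]]].
  exists (Bp :|: Bp'), (Bn :|: Bn'); split.
  - rewrite (leq_trans (leq_card_setU _ _)) //= mulSn addnC.
    by rewrite leq_add.
  - rewrite (leq_trans (leq_mul (leq_card_setU _ _) (leqnn _))) //= mulSn mulnDl addnC.
    by rewrite leq_add.
  - move=> g; rewrite inE => /orP[/eqP->|/hc[A' hA']]; first by exists A.
    by exists A'; apply: approximatesW hA'; apply: subsetUl.
(* Constants and variables are represented without error. *)
have exact c Bp Bn f A : approximator L q A ->
    (forall G, G \in f = accepts A G) ->
    [/\ #|Bp| <= size c * (2 * M ^ 2 * (n - L.+1)`!),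
        #|Bn| * 2 ^ q <= size c * (2 * M ^ 2 * #|{: coloring}|) &
        {in c, forall f, exists A, approximates Bp Bn f A}] ->
  exists Bp Bn,
    [/\ #|Bp| <= size (f :: c) * (2 * M ^ 2 * (n - L.+1)`!),
        #|Bn| * 2 ^ q <= size (f :: c) * (2 * M ^ 2 * #|{: coloring}|) &
        {in f :: c, forall f, exists A, approximates Bp Bn f A}].
  move=> apA fA hc; apply: step hc _; exists set0, set0, A.
  by rewrite !cards0; split=> //; split=> // [s|h] _; rewrite fA.
move=> c; elim=> {c} [|c cc [Bp [Bn IH]]|c cc [Bp [Bn IH]]|c e cc [Bp [Bn IH]]
           |c f g cc [Bp [Bn IH]] cf cg|c f g cc [Bp [Bn IH]] cf cg].
- by exists set0, set0; rewrite !cards0; split=> // f; rewrite in_nil.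
- apply: (exact _ _ _ _ [set set0]) IH; first apply/andP; first split.
  + apply/forall_inP => E; rewrite inE => /eqP->; apply/andP; split.
      by apply/matchingP=> e; rewrite inE.
    by rewrite cards0.
  + by rewrite cards1.
  + move=> G; rewrite inE; apply/esym/exists_inP; exists set0; rewrite ?inE //.
    exact: sub0set.
- apply: (exact _ _ _ _ set0) IH; first apply/andP; first split.
  + by apply/forall_inP => E; rewrite inE.
  + by rewrite cards0.
  + by move=> G; rewrite inE; apply/esym/exists_inP => -[E]; rewrite inE.
- apply: (exact _ _ _ _ [set [set e]]) IH; first apply/andP; first split.
  + apply/forall_inP => E; rewrite inE => /eqP->; apply/andP; split.
      by apply/matchingP=> e1 e2; rewrite !inE => /eqP-> /eqP->.
    by rewrite cards1.
  + by rewrite cards1.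
  + move=> G; rewrite inE; apply/idP/exists_inP => [eG|[E]].
      by exists [set e]; rewrite ?inE // sub1set.
    by rewrite inE => /eqP->; rewrite sub1set.
- apply: (step _ _ _ _ IH); case: IH => _ _ IH.
  have [A [apA pA nA]] := IH f cf; have [A' [apA' pA' nA']] := IH g cg.
  have [A'' [apA'' pA'' nA'']] := approximate_and q_large apA apA'.
  move: pA'' nA''; set Bp' := finset _; set Bn' := finset _ => cp cn.
  exists Bp', Bn', A''; split=> //; split=> // [s|h]; rewrite !inE negb_or.
    case/andP=> sB sB' /andP[/(pA s sB) h1 /(pA' s sB) h2].
    by apply: contraR sB' => h3; rewrite h1 h2.
  case/andP=> hB hB' hA''; move: hB'; rewrite hA'' negbK => /andP[h1 h2].
  by rewrite nA // nA'.
- apply: (step _ _ _ _ IH); case: IH => _ _ IH.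
  have [A [apA pA nA]] := IH f cf; have [A' [apA' pA' nA']] := IH g cg.
  have [A'' [apA'' pA'' nA'']] := approximate_or q_large apA apA'.
  move: nA''; set Bn' := finset _ => cn.
  exists set0, Bn', A''; rewrite cards0; split=> //; split=> // [s|h].
    rewrite setU0 inE => sB /orP[/(pA s sB) h1|/(pA' s sB) h1].
      by rewrite pA'' ?h1.
    by rewrite pA'' ?h1 ?orbT.
  rewrite !inE negb_or.
  case/andP=> hB hB' hA''; move: hB'; rewrite hA'' negbK => /orP[h1|h1].
    by rewrite nA.
  by rewrite orbC nA'.
Qed.

End CircuitApproximation.

(** * The lower bound for monotone circuits *)

Lemma expn_le_fact m k : k <= m -> (m - k).+1 ^ k * (m - k)`! <= m`!.
Proof.
elim: k m => [|k IH] m; first by rewrite subn0 mul1n.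
case: m => // m km; rewrite subSS factS expnS -mulnA leq_mul ?ltnS ?leq_subr //.
exact: IH.
Qed.

(** The value 11 is the first at which the inequality holds. *)
Lemma quadratic_lt_exp2 L : 11 <= L -> 13 * L ^ 2 + L + 2 < 2 ^ L.
Proof.
elim: L => // L IH; rewrite leq_eqVlt => /orP[/eqP<- //|L11].
have := IH L11; rewrite (expnS 2) -!mulnn; have := leq_mul (ltnW L11) (leqnn L).
move: (2 ^ L) => x; nia.
Qed.

Section LowerBound.
Variables (n L : nat).
Local Notation vertex := ('I_n + 'I_n)%type.
Local Notation edge := ('I_n * 'I_n)%type.
Local Notation coloring := {ffun vertex -> bool}.
Implicit Types (f : {set {set edge}}) (h : coloring) (s : 'S_n).
Implicit Types (A : {set {set edge}}) (Bp : {set 'S_n}) (Bn : {set coloring}).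

Definition parity h : bool := \big[addb/false]_v h v.

Lemma parity_flip w h : parity (flip w h) = ~~ parity h.
Proof.
rewrite /parity (bigD1 w) //= [in RHS](bigD1 w) //= ffunE eqxx addTb -addNb.
congr (_ (+) _); apply: eq_bigr => v /negbTE vw; by rewrite ffunE vw.
Qed.

Lemma max_terms_exp : 11 <= L -> max_terms L (2 ^ L) <= 2 ^ (6 * L ^ 2).
Proof.
move=> L11; have -> : 6 * L ^ 2 = 3 * L * (2 * L) by rewrite -mulnn; lia.
rewrite expnM leq_exp2r; last by lia.
have -> : 2 ^ (3 * L) = 2 ^ L * (2 ^ L * 2 ^ L) by rewrite -!expnD; congr (_ ^ _); lia.
rewrite mulnAC leq_mul //.
by have := quadratic_lt_exp2 L11; rewrite -mulnn; nia.
Qed.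

Theorem matching_circuit_lower_bound c f (i : 'I_n) :
    11 <= L -> n = 2 ^ (15 * L) -> circuit c -> f \in c ->
    (forall s, s i = i -> perm_graph s \in f) ->
    (forall h, parity h -> monochromatic h \notin f) ->
  2 ^ (L ^ 2) < size c.
Proof.
move=> L11 nE cc cf fpos fneg; rewrite ltnNge; apply/negP=> csz.
have L_gt0 : 0 < L by lia.
have q_large : 1 < 2 ^ L * 2 ^ L.
  by rewrite -expnD -{1}(expn0 2) ltn_exp2l // addn_gt0 L_gt0.
have [Bp [Bn [cp cn /(_ f cf)[A [/andP[/forall_inP tA _] pA nA]]]]] :=
  approximate_circuit q_large L_gt0 cc.
have cost : size c * (2 * max_terms L (2 ^ L) ^ 2) <= 2 ^ (13 * L ^ 2 + 1).
  have -> : 13 * L ^ 2 + 1 = L ^ 2 + (1 + (6 * L ^ 2) * 2) by lia.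
  rewrite !expnD expnM leq_mul // leq_mul // leq_exp2r //.
  exact: max_terms_exp.
have Ln : 2 * L <= n.
  have := quadratic_lt_exp2 L11; have : 2 ^ L <= n by rewrite nE leq_exp2l //; lia.
  by rewrite -mulnn; nia.
(* If [A] is empty, [Bp] contains all (n-1)! permutations fixing [i], which is at least (n - L)^L (n
   - L - 1)!, while (n - L)^L >= (n / 2)^L = 2^(15 L^2 - L). *)
have [A0|/set0Pn[E EA]] := eqVneq A set0.
  have sub : [set s : 'S_n | s i == i] \subset Bp.
    apply/subsetP=> s; rewrite inE => /eqP /fpos fs; apply: contraT => /pA/(_ fs).
    by rewrite A0 => /exists_inP[E]; rewrite inE.
  have := leq_trans (perm_graph_fix_card i) (leq_trans (subset_leq_card sub) cp).
  have Ln1 : L <= n.-1 by lia.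
  rewrite leqNgt => /negP; apply.
  apply: leq_trans (expn_le_fact Ln1).
  have -> : n.-1 - L = n - L.+1 by lia.
  rewrite mulnA ltn_pmul2r ?fact_gt0 //; apply: (leq_ltn_trans cost).
  apply: (@leq_trans ((2 ^ (15 * L - 1)) ^ L)).
    rewrite -expnM ltn_exp2l // -mulnn; nia.
  rewrite leq_exp2r //.
  have : 2 * 2 ^ (15 * L - 1) = n by rewrite -expnS nE; congr (_ ^ _); lia.
  lia.
have /andP[mE cE] := tA E EA.
(* Flipping a vertex not covered by [E] changes the parity and keeps [E] monochromatic, so half of
   the colorings accepted through [E] are odd. *)
have [i0 i0E] : exists i0, i0 \notin [set e.1 | e in E].
  apply/existsP; rewrite -negb_forall; apply/negP=> /forallP all.
  have : #|[set: 'I_n]| <= #|E|.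
    apply: leq_trans (leq_imset_card fst E).
    by apply: subset_leq_card; apply/subsetP=> j _; apply: all.
  by rewrite cardsT card_ord; lia.
have h1 := @card_monochromatic n setT setT E mE.
have {h1}h1 : 2 ^ #|E| * #|[set h in [set: coloring] | E \subset monochromatic h]| =
   #|{: coloring}|.
  rewrite h1 ?cardsT // => [w _ h _|e Ee]; first by rewrite inE.
  by exists (inl e.1); rewrite // /incident eqxx.
set B := [set h in _ | _] in h1.
have i0c : inl i0 \notin cover E.
  rewrite inE negb_or; apply/andP; split.
    by apply: contra i0E => /imsetP[e Ee [->]]; apply/imsetP; exists e.
  by apply/negP=> /imsetP[e].
have h2 : 2 * #|[set h in B | parity h]| = #|B|.
  apply: (@card_flip_half _ _ _ (inl i0)) => h; last by rewrite parity_flip.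
  by rewrite !inE monochromatic_flip_notin.
have sub : [set h in B | parity h] \subset Bn.
  apply/subsetP=> h; rewrite !inE /= => /andP[Eh ph]; apply: contraT => /nA nh.
  have := fneg h ph; rewrite nh //; apply/exists_inP; by exists E.
have col0 : 0 < #|{: coloring}| by apply/card_gt0P; exists [ffun=> false].
have : #|{: coloring}| * 2 ^ (2 ^ L) <= 2 ^ (13 * L ^ 2 + L + 2) * #|{: coloring}|.
  rewrite -[X in X * _]h1 -h2.
  apply: (@leq_trans (2 ^ L.+1 * (#|Bn| * 2 ^ 2 ^ L))).
    rewrite expnSr !mulnA leq_mul // leq_mul ?subset_leq_card //.
    by rewrite leq_mul // leq_exp2l.
  rewrite (leq_trans (leq_mul (leqnn _) cn)) //.
  rewrite (mulnA (size c)) (mulnA (2 ^ L.+1)) leq_mul //.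
  rewrite (leq_trans (leq_mul (leqnn _) cost)) // -expnD leq_exp2l //.
  lia.
rewrite mulnC leq_pmul2r // leq_exp2l // leqNgt quadratic_lt_exp2 //.
Qed.

End LowerBound.

(** * Circuits simulating unit propagation *)

Section CircuitConstructions.
Variable T : finType.
Implicit Types (c : seq {set {set T}}) (f g : {set {set T}}).

Definition extends c k c' : Prop :=
  [/\ circuit c', {subset c <= c'} & size c' <= size c + k].

Lemma extends_refl c : circuit c -> extends c 0 c.
Proof. by move=> cc; split; rewrite ?addn0. Qed.

Lemma extends_trans c1 c2 c3 k k' :
  extends c1 k c2 -> extends c2 k' c3 -> extends c1 (k + k') c3.
Proof.
case=> _ s12 z12 [c3c s23 z23]; split=> //; first by move=> f /s12/s23.
by rewrite addnA (leq_trans z23) // leq_add2r.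
Qed.

Lemma extendsW c k k' c' : k <= k' -> extends c k c' -> extends c k' c'.
Proof. by move=> kk [? ? z]; split=> //; rewrite (leq_trans z) // leq_add2l. Qed.

Lemma extends_cons c f : circuit (f :: c) -> extends c 1 (f :: c).
Proof. by split=> // [g gc|]; rewrite ?inE ?gc ?orbT //= addn1. Qed.

Lemma circuit_bigcup (I : eqType) (r : seq I) (P : pred I) (h : I -> {set {set T}}) c :
    circuit c -> {in r, forall i, P i -> h i \in c} ->
  exists2 c', extends c (size r).+1 c' & \bigcup_(i <- r | P i) h i \in c'.
Proof.
move=> cc; elim: r => [|i r IH] hc.
  exists (set0 :: c); first exact/extends_cons/circuit_false.
  by rewrite big_nil inE eqxx.
have [|c' cc' hc'] := IH; first by move=> j jr; apply: hc; rewrite inE jr orbT.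
rewrite big_cons; case: (boolP (P i)) => [Pi|nPi]; last first.
  by exists c' => //; apply: extendsW cc'.
exists (h i :|: \bigcup_(j <- r | P j) h j :: c'); last by rewrite inE eqxx.
rewrite -addn1; apply: (extends_trans cc' (extends_cons _)).
case: cc' => cc' sub _.
by apply: circuit_or => //; apply: sub; apply: hc; rewrite ?inE ?eqxx.
Qed.

(** The conjuncts need not be present in [c]: each can be built with [k i] gates on top of any
    extension of it. *)
Lemma circuit_bigcap (I : eqType) (r : seq I) (P : pred I)
    (h : I -> {set {set T}}) (k : I -> nat) c :
    circuit c ->
    {in r, forall i c', P i -> circuit c' -> {subset c <= c'} ->
      exists2 c'', extends c' (k i) c'' & h i \in c''} ->
  exists2 c', extends c (\sum_(i <- r | P i) (k i).+1).+1 c' &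
    \bigcap_(i <- r | P i) h i \in c'.
Proof.
move=> cc; elim: r => [|i r IH] hc.
  exists (setT :: c); last by rewrite big_nil inE eqxx.
  by rewrite big_nil; apply/extends_cons/circuit_true.
have [|c' cc' hc'] := IH; first by move=> j jr; apply: hc; rewrite inE jr orbT.
rewrite !big_cons; case: (boolP (P i)) => [Pi|nPi]; last by exists c'.
have [c'c sub _] := cc'.
have [|c'' cc'' hc''] := hc i _ c' Pi c'c sub; first by rewrite inE eqxx.
exists (h i :&: \bigcap_(j <- r | P j) h j :: c''); last by rewrite inE eqxx.
have [c''c sub' _] := cc''.
have ext : extends c'' 1 (h i :&: \bigcap_(j <- r | P j) h j :: c'').
  by apply/extends_cons/circuit_and => //; apply: sub'.
by apply: extendsW (extends_trans cc' (extends_trans cc'' ext)); lia.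
Qed.

End CircuitConstructions.

Section UnitPropagation.
Variables (T W : finType) (F : cnf W).
Local Notation atom := (W * bool)%type.

(* The atom [a] is true initially iff the input variable [source a] is off.   *)
Variable source : atom -> option T.
Implicit Types (G : {set T}) (X : {set atom}) (a b : atom).

Definition initial G a : bool := if source a is Some e then e \notin G else false.

(** One round of unit propagation. A literal and its negation are separate atoms, which makes the
    rule Horn, hence monotone in [X]. *)
Definition derive G X : {set atom} :=
  [set a | initial G a ||
    has (fun c => (a \in c) && all (fun b => (b == a) || (negl b \in X)) c) F].

Lemma derive_mono G : {homo derive G : X X' / X \subset X'}.
Proof.
move=> X X' /subsetP sX; apply/subsetP=> a; rewrite !inE.
case/orP=> [->//|/hasP[c cF /andP[ac /allP aX]]]; apply/orP; right.
apply/hasP; exists c; rewrite // ac; apply/allP=> b /aX /orP[->//|/sX ->].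
by rewrite orbT.
Qed.

Lemma up_fixset G rho a :
    (forall w v, rho w = Some v <-> initial G (w, v)) ->
  up F rho a <-> a \in fixset (derive G).
Proof.
move=> rhoE; split.
  elim=> [w v /rhoE iv|c b cF bc _ IH]; rewrite -(fixsetK (@derive_mono G)) inE ?iv //.
  apply/orP; right; apply/hasP; exists c; rewrite // bc; apply/allP=> b' b'c.
  by case: eqP => //= /eqP nb; apply: IH.
rewrite /fixset; move: #|_| => k; elim: k a => [|k IH] a /=; rewrite inE //.
case/orP=> [|/hasP[c cF /andP[ac /allP aX]]].
  by case: a => w v iv; apply/up_start/rhoE.
apply: (up_unit cF ac) => b /aX /orP[->//|/IH //].
Qed.

Definition underived k a : {set {set T}} :=
  [set G | a \notin iter k (derive G) set0].

(** De Morgan dual of a round: every clause containing [a] must have another literal whose negation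
    is underived. Only unions and intersections remain, and inputs occur positively. *)
Lemma underivedS k a :
  underived k.+1 a =
    [set G | ~~ initial G a] :&:
    \bigcap_(c <- F | a \in c) \bigcup_(b <- c | b != a) underived k (negl b).
Proof.
apply/setP=> G; rewrite !inE negb_or; congr (_ && _).
elim: (F) => [|c F' IH]; first by rewrite big_nil inE.
rewrite /= negb_or big_cons; case: (boolP (a \in c)) => //= ac.
rewrite inE -IH; congr (_ && _); elim: (c) => [|b c' IH']; first by rewrite big_nil inE.
rewrite /= negb_and big_cons negb_or IH'; case: (b == a) => //=.
by rewrite !inE.
Qed.

Lemma extend_underivedS k a c : circuit c ->
    (forall b, underived k b \in c) ->
  exists2 c', extends c (3 * cnf_size F + 3) c' & underived k.+1 a \in c'.
Proof.
move=> cc cu.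
have [c1 ext1 in1] : exists2 c1, extends c 1 c1 & [set G | ~~ initial G a] \in c1.
  rewrite /initial; case: (source a) => [e|].
    exists ([set G : {set T} | e \in G] :: c); first exact/extends_cons/circuit_var.
    under eq_finset => G do rewrite negbK.
    by rewrite inE eqxx.
  exists (setT :: c); first exact/extends_cons/circuit_true.
  by rewrite inE; apply/orP; left; apply/eqP/setP=> G; rewrite !inE.
have [cc1 sub1 _] := ext1.
pose h (cl : clause W) := \bigcup_(b <- cl | b != a) underived k (negl b).
have [c2 ext2 in2] := @circuit_bigcap _ _ F (fun cl => a \in cl) h
  (fun cl => (size cl).+1) c1 cc1 (fun cl _ c' _ cc' sub' =>
     circuit_bigcup cc' (fun b _ _ => sub' _ (sub1 _ (cu (negl b))))).
have [cc2 sub2 _] := ext2.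
exists (underived k.+1 a :: c2); last by rewrite inE eqxx.
have ext3 : extends c2 1 (underived k.+1 a :: c2).
  by rewrite underivedS; apply/extends_cons/circuit_and => //; apply: sub2.
apply: extendsW (extends_trans ext1 (extends_trans ext2 ext3)).
(* A clause containing [a] is nonempty, so its size plus 2 is at most three times its size. *)
suff : \sum_(cl <- F | a \in cl) (size cl).+2 <= 3 * cnf_size F.
  by rewrite /=; move: (\sum_(cl <- F | _) _) (cnf_size F) => x S; lia.
rewrite /cnf_size big_distrr /= big_mkcond /=; apply: leq_sum => cl _.
by case: cl => // b cl; case: ifP => //= _; lia.
Qed.

Lemma extend_underived_all k c (r : seq atom) : circuit c ->
    (forall b, underived k b \in c) ->
  exists2 c', extends c (size r * (3 * cnf_size F + 3)) c' &
    {in r, forall a, underived k.+1 a \in c'}.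
Proof.
move=> cc cu; elim: r => [|a r [c1 ext1 in1]]; first by exists c; first exact: extends_refl.
have [cc1 sub1 _] := ext1.
have [c2 ext2 in2] := @extend_underivedS k a c1 cc1 (fun b => sub1 _ (cu b)).
exists c2; first by rewrite /= mulSn addnC; apply: extends_trans ext1 ext2.
move=> b; rewrite inE => /orP[/eqP->//|/in1].
by case: ext2 => _ + _; apply.
Qed.

Lemma circuit_underived k :
  exists c, [/\ circuit c, forall a, underived k a \in c &
    size c <= k * (#|{: atom}| * (3 * cnf_size F + 3)) + 1].
Proof.
elim: k => [|k [c [cc cu cz]]].
  exists [:: setT]; split=> //; first exact/circuit_true/circuit_nil.
  by move=> a; rewrite inE; apply/eqP/setP=> G; rewrite !inE.
have [c' [cc' _ cz'] in'] := extend_underived_all (enum {: atom}) cc cu.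
exists c'; split=> // [a|]; first by rewrite in' // mem_enum.
by rewrite (leq_trans cz') // -cardE (mulSn k) -addnA addnC leq_add2l.
Qed.

End UnitPropagation.

(** * From decompositions of AllDifferent to matching circuits *)

Section AllDifferent.
Variable n : nat.
Local Notation edge := ('I_n * 'I_n)%type.
Local Notation full := (fun _ : 'I_n => [set: 'I_n]).
Implicit Types (G : {set edge}) (h : {ffun 'I_n + 'I_n -> bool}).

Lemma card_full_literal : #|{: literal full}| = n ^ 2.
Proof.
rewrite card_sig; transitivity #|{: edge}|; last by rewrite card_prod !card_ord.
by apply: eq_card => e; rewrite !inE.
Qed.

Definition setting G : {set literal full} := [set l | val l \in G].

Definition setting_inst G : literal full -> option bool :=
  fun l => if val l \in G then None else Some false.

Definition edge_literal (e : edge) : literal full := Sub e (in_setT e.2).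

Lemma setting_represents G : represents (setting G) (setting_inst G).
Proof. by move=> l; rewrite inE /setting_inst; case: ifP. Qed.

Lemma within_setting G (a : assignment 'I_n 'I_n) :
  within (setting G) a = [forall i, (i, a i) \in G].
Proof.
apply: eq_forallb => i; apply/imsetP/idP => [[l + ->]|iG].
  by rewrite inE.
by exists (edge_literal (i, a i)); rewrite ?inE.
Qed.

Lemma dc_perm_graph (s : 'S_n) i : s i = i ->
  edge_literal (i, i) \in dc_propagator (@alldifferent _ _) (setting (perm_graph s)).
Proof.
move=> si; rewrite !inE /= si eqxx; apply/existsP; exists [ffun j => s j].
rewrite ffunE /= si eqxx andbT within_setting; apply/andP; split.
  by apply/injectiveP=> j k; rewrite !ffunE; apply: perm_inj.
by apply/forallP=> j; rewrite ffunE inE.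
Qed.

Lemma dc_monochromatic h l : parity h ->
  l \notin dc_propagator (@alldifferent _ _) (setting (monochromatic h)).
Proof.
move=> ph; rewrite inE negb_and; apply/orP; right; apply/existsP=> -[a].
case/and3P=> /injectiveP ainj; rewrite within_setting => /forallP ha _.
(* The solution [a] is a bijection along monochromatic edges, so the colors on the two sides have
   the same sum and cancel. *)
move: ph; rewrite /parity big_sumType /= [X in _ (+) X](reindex a) /=; last first.
  by apply: onW_bij; apply: injF_bij.
rewrite (eq_bigr (fun i => h (inr (a i)))) ?addbb // => i _.
by have := ha i; rewrite inE => /eqP.
Qed.

Lemma alldifferent_circuit (Y : finType) (F : cnf (literal full + Y)%type)
    (q : {poly rat}) (i : 'I_n) :
    cnf_decomposition q (dc_propagator (@alldifferent _ _)) F ->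
  exists c f, [/\ circuit c, f \in c,
    size c <= (2 * (n ^ 2 + #|Y|)) ^ 2 * (3 * cnf_size F + 3) + 1,
    forall s : 'S_n, s i = i -> perm_graph s \in f &
    forall h, parity h -> monochromatic h \notin f].
Proof.
case=> _ dec.
pose source (a : (literal full + Y) * bool) : option edge :=
  if a is (inl l, false) then Some (val l) else None.
(* As many rounds as there are atoms reach the fixpoint. *)
set N := #|{: (literal full + Y) * bool}|.
have [c [cc cu cz]] := circuit_underived F source N.
exists c, (underived F source N (inl (edge_literal (i, i)), false)).
have fE G : G \in underived F source N (inl (edge_literal (i, i)), false) <->
    edge_literal (i, i) \in dc_propagator (@alldifferent _ _) (setting G).
  have [/(_ (edge_literal (i, i))) upE _] := dec _ _ (setting_represents G).
  have uf : forall w v, unset_aux (Y := Y) (setting_inst G) w = Some v <->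
      initial source G (w, v).
    move=> [l|y] v; rewrite /initial /source /unset_aux /setting_inst; last by split.
    by case: ifP => lG; case: v; rewrite /= ?lG.
  have := up_fixset F (inl (edge_literal (i, i)), false) uf.
  rewrite upE /fixset -/N => e; rewrite [_ \in underived _ _ _ _]inE; split=> [/negP nf|dG].
    by apply: contraT => /e hi; case: (nf hi).
  by apply/negP=> /e; rewrite dG.
split=> //.
- exact: cu.
- have NE : N = 2 * (n ^ 2 + #|Y|).
    by rewrite /N card_prod card_sum card_bool card_full_literal mulnC.
  by rewrite (leq_trans cz) // leq_add2r mulnA -mulnn -NE leq_mul.
- by move=> s si; apply/fE/dc_perm_graph.
- by move=> h ph; apply/negP=> /fE; apply/negP/dc_monochromatic.
Qed.

End AllDifferent.

(** * Polynomial bounds and the final contradiction *)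

Lemma poly_nat_bound (p : {poly rat}) :
  exists d, forall m, (p.[m%:R] <= ((m + d) ^ d)%:R)%R.
Proof.
elim/poly_ind: p => [|p c [d IH]]; first by exists 0 => m; rewrite horner0.
have [b cb] : exists b : nat, (c <= b%:R)%R.
  exists (Num.Def.archi_bound `|c|%R).
  apply: Order.POrderTheory.le_trans (Num.Theory.ler_norm c) _.
  exact/Order.POrderTheory.ltW/Num.Theory.archi_boundP.
exists (d + b).+1 => m; rewrite hornerMXaddC.
apply: (@Order.POrderTheory.le_trans _ _ (((m + d) ^ d)%:R * m%:R + b%:R)%R).
  by apply: Num.Theory.lerD => //; apply: Num.Theory.ler_wpM2r.
rewrite -GRing.natrM -GRing.natrD Num.Theory.ler_nat.
have pos : 0 < (m + d) ^ d by case: (d) => // d'; rewrite expn_gt0 addnS.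
have le : (m + d) ^ d <= (m + (d + b).+1) ^ (d + b).
  apply: (@leq_trans ((m + (d + b).+1) ^ d)).
    by case: (d) => // d'; rewrite leq_exp2r //; lia.
  by rewrite leq_pexp2l; lia.
rewrite expnS; move: pos le; move: (_ ^ d) (_ ^ (d + b)) => x y; nia.
Qed.

Theorem corollary4 :
  ~ exists q p : {poly rat},
      forall (X V : finType) (D : X -> {set V}),
      exists (Y : finType) (F : cnf (literal D + Y)%type),
        cnf_decomposition q (dc_propagator (D := D) (@alldifferent X V)) F /\
        ((cnf_size F)%:R <= p.[#|{: literal D}|%:R])%R.
Proof.
case=> q [p dec].
have [d1 qd] := poly_nat_bound q; have [d2 pd] := poly_nat_bound p.
(* All sizes will be at most [B] = 2^(31 L d), since n^2 = 2^(30 L). The circuit has size at most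
   2^7 B^3 = 2^(93 L d + 7), below 2^(L^2) = 2^(100 L d). *)
pose d := (d1 + d2).+1; pose L := 100 * d; pose n := 2 ^ (15 * L).
have [Y [F [decF sizeF]]] := dec 'I_n 'I_n (fun _ => [set: 'I_n]).
pose B := 2 ^ (31 * L * d).
have powB k : k < d -> (n ^ 2 + k) ^ k <= B.
  move=> kd; apply: (@leq_trans ((2 ^ (31 * L)) ^ k)); last first.
    by rewrite -expnM leq_exp2l // leq_mul2l ltnW ?orbT.
  case: k kd => // k kd; rewrite leq_exp2r //.
  have kL : k.+1 <= 2 ^ (30 * L).
    rewrite ltnW // (leq_trans (ltn_expl _ (isT : 1 < 2))) // leq_exp2l // /L; lia.
  rewrite /n -expnM; have -> : 15 * L * 2 = 30 * L by lia.
  apply: (leq_trans (leq_add (leqnn _) kL)); rewrite addnn -mul2n -expnS leq_exp2l //.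
  rewrite /L; lia.
have nB : n ^ 2 <= B.
  by rewrite /n /B -expnM leq_exp2l // /d; nia.
have YB : #|Y| <= B.
  have [qY _] := decF.
  apply: leq_trans (powB d1 _); last by rewrite /d; lia.
  rewrite -(Num.Theory.ler_nat rat) -card_full_literal.
  exact: (Order.POrderTheory.le_trans qY (qd _)).
have SB : cnf_size F <= B.
  apply: leq_trans (powB d2 _); last by rewrite /d; lia.
  rewrite -(Num.Theory.ler_nat rat) -card_full_literal.
  exact: (Order.POrderTheory.le_trans sizeF (pd _)).
have i : 'I_n by apply: (@Ordinal n 0); rewrite expn_gt0.
have [c [f [cc cf cz fp fn]]] := alldifferent_circuit i decF.
have L11 : 11 <= L by rewrite /L /d; lia.
have := matching_circuit_lower_bound L11 (erefl n) cc cf fp fn.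
rewrite ltnNge => /negP; apply.
apply: (leq_trans cz); apply: (@leq_trans (2 ^ 7 * B ^ 3)).
  apply: (@leq_trans ((2 * (B + B)) ^ 2 * (3 * B + 3) + 1)).
    rewrite leq_add2r leq_mul ?leq_exp2r ?leq_add2r ?leq_mul2l //=.
    by rewrite leq_add.
  have : 0 < B by rewrite expn_gt0.
  rewrite !expnS expn0; nia.
rewrite /B -expnM -expnD leq_exp2l //; rewrite -mulnn /L; nia.
Qed.
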